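(* Let $n \ge m$ and let $X \in \mathbb{R}^{n\times m}$ be an orthogonal design, i.e. $X^\top X = I_m$. Suppose $y = X\beta + \epsilon$ with unknown $\beta \in \mathbb{R}^m$ and noise $\epsilon \sim N(0,\sigma^2 I_n)$ with known $\sigma>0$. Fix an integer $k$ with $1 \le k \le m$ and a level $\alpha \in (0,1)$. Define the sequence $$\lambda_{k\text{-FWER}}(i)=\begin{cases}\Phi^{-1}\!\left(1-\dfrac{k\alpha}{2m}\right), & i\le k,\\[2mm] \Phi^{-1}\!\left(1-\dfrac{k\alpha}{2(m+k-i)}\right), & k< i\le m,\end{cases}$$ and let $\hat\beta$ be the $k$-SLOPE estimator $$\hat\beta \in \arg\min_{b\in\mathbb{R}^m}\ \frac12\|y-Xb\|_2^2+\sigma\sum_{i=1}^m \lambda_{k\text{-FWER}}(i)\,|b|_{(i)}.$$ Let $V$ be the number of indices $i$ with $\beta_i = 0$ but $\hat\beta_i \neq 0$ (false selections). Then $$k\text{-FWER} := \mathrm{Prob}\{V \ge k\} \le \alpha.$$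
   Context: $\Phi$ denotes the cumulative distribution function of the standard normal distribution and $\Phi^{-1}$ its inverse. For $b\in\mathbb{R}^m$, $|b|_{(1)}\ge |b|_{(2)}\ge\cdots\ge |b|_{(m)}$ denote the absolute values of the entries of $b$ sorted in non-increasing order. Feature $i$ is ''selected'' (the null hypothesis $H_i:\beta_i=0$ is rejected) when $\hat\beta_i\neq 0$. *)

(* Defs.v *)
From HB Require Import structures.
From mathcomp Require Import all_boot all_order all_algebra.
From mathcomp Require Import all_classical all_reals all_analysis.
Set Implicit Arguments. Unset Strict Implicit. Unset Printing Implicit Defensive.
Import Order.TTheory GRing.Theory Num.Theory.
Local Open Scope classical_set_scope.
Local Open Scope ring_scope.

Section kslope_defs.
Variable R : realType.

Definition Phi (x : R) : R := fine (normal_prob 0 1 `]-oo, x]).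

(* Quantile function (inverse CDF), for p in (0,1). *)
Definition Phi_inv (p : R) : R := inf [set x : R | p <= Phi x].

(* lambda_{k-FWER}(i) for 1-based index i (1 <= i <= m). *)
Definition lambda_kfwer (m k : nat) (alpha : R) (i : nat) : R :=
  if (i <= k)%N then Phi_inv (1 - k%:R * alpha / (2 * m%:R))
  else Phi_inv (1 - k%:R * alpha / (2 * (m + k - i)%:R)).

Definition sorted_abs (m : nat) (b : 'cV[R]_m) : seq R :=
  sort (fun x y : R => y <= x) [seq `|b j 0| | j <- enum 'I_m].

(* |b|_(i), 1-based i *)
Definition ord_abs (m : nat) (b : 'cV[R]_m) (i : nat) : R :=
  nth 0 (sorted_abs b) i.-1.

Definition sqnorm (n : nat) (v : 'cV[R]_n) : R := \sum_(i < n) (v i 0) ^+ 2.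

Definition kslope_obj (n m k : nat) (alpha sigma : R) (X : 'M[R]_(n, m))
    (y : 'cV[R]_n) (b : 'cV[R]_m) : R :=
  2^-1 * sqnorm (y - X *m b)
  + sigma * \sum_(i < m) lambda_kfwer m k alpha i.+1 * ord_abs b i.+1.

End kslope_defs.

Definition mutually_independent d (T : measurableType d) (R : realType)
    (P : probability T R) (n : nat) (Xs : 'I_n -> T -> R) : Prop :=
  forall B : 'I_n -> set R, (forall i, measurable (B i)) ->
    P (\bigcap_(i in [set: 'I_n]) (Xs i @^-1` B i)) =
    (\prod_(i < n) P (Xs i @^-1` B i))%E.

(* Main.v *)
Require Import Defs.
From HB Require Import structures.
From mathcomp Require Import all_boot all_order all_algebra all_fingroup.
From mathcomp Require Import all_classical all_reals all_analysis.
From mathcomp Require Import measurable_realfun zify ring lra.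
Import Order.TTheory GRing.Theory Num.Theory.
Local Open Scope classical_set_scope.
Local Open Scope ring_scope.
Import numFieldNormedType.Exports.
Set Implicit Arguments. Unset Strict Implicit. Unset Printing Implicit Defensive.

(** The estimator is compared with a Simes test on the true nulls. If [b]
    minimizes the objective, has [r] nonzero entries and [b_i <> 0], then
    zeroing [b_i] lowers the sorted penalty by at least
    [sigma lambda_r |b_i|], so minimality forces
    [|(X^T y)_i| > sigma lambda_r]. With [V >= k] false selections among [m0]
    nulls, [r <= V + m - m0], and [k m0 <= V (m0 + k - V)] turns this into
    [V] null p-values below [V alpha / m0]: the Simes event, whose probability
    is at most [alpha] for independent p-values.

    Independence of the entries of [X^T eps] is obtained by reducing [X] to
    diagonal form by plane rotations: each rotation is a product of three
    shears, so it preserves Lebesgue measure on the plane and therefore the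
    product of two standard normal laws. Measurability of the event holds
    because the minimizer is a Lipschitz function of the data. *)

(** * The sorted l1 penalty *)

Section rearrangement.
Context {R : realDomainType} (m : nat) (L x : 'I_m -> R).
Hypothesis ndL : forall i j : 'I_m, (i <= j)%N -> L j <= L i.
Hypothesis ndx : forall i j : 'I_m, (i <= j)%N -> x j <= x i.

(** Selection sort: [s] is turned into the identity one position at a time, each transposition
    changing the sum by a product of two nonnegative differences. *)
Lemma rearrangement (s : 'S_m) :
  \sum_i L i * x (s i) <= \sum_i L i * x i.
Proof.
suff H t : (t <= m)%N -> exists2 s' : 'S_m, forall i : 'I_m, (i < t)%N -> s' i = i &
    \sum_i L i * x (s i) <= \sum_i L i * x (s' i).
  have [s' s'E] := H m (leqnn m).
  by under [leRHS]eq_bigr do rewrite s'E//.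
elim: t => [_|t IH tm]; first by exists s.
have [s' s'E sle] := IH (ltnW tm).
pose it : 'I_m := Ordinal tm; pose p := (s'^-1)%g it.
have s'p : s' p = it by rewrite permKV.
exists (tperm it p * s')%g => [i|].
  rewrite ltnS leq_eqVlt permM => /orP[/eqP i_t|i_t].
    by have -> : i = it by [exact: val_inj]; rewrite tpermL.
  rewrite tpermD ?s'E//.
    by apply/eqP => /(congr1 val)/= ti; rewrite ti ltnn in i_t.
  apply/eqP => pi; move: (congr1 val s'p); rewrite pi s'E// => /= ti.
  by rewrite ti ltnn in i_t.
apply: le_trans sle _.
have [pE|pit] := eqVneq p it; first by rewrite pE tperm1 mul1g.
have tp : (t <= p)%N.
  by rewrite leqNgt; apply: contra pit => /s'E; rewrite s'p => ->.
have tsit : (t <= s' it)%N.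
  rewrite leqNgt; apply/negP => /[dup] lt /s'E /perm_inj e.
  by move: lt; rewrite e ltnn.
rewrite (bigD1 it)//= (bigD1 p)//= [leRHS](bigD1 it)//= [X in _ <= _ + X](bigD1 p)//=.
rewrite !addrA lerD//; last first.
  apply: ler_sum => i /andP[iit ip].
  by rewrite permM tpermD// eq_sym.
rewrite !permM tpermL tpermR s'p -subr_ge0.
have -> : L it * x it + L p * x (s' it) - (L it * x (s' it) + L p * x it) =
  (L it - L p) * (x it - x (s' it)) by ring.
by rewrite mulr_ge0// subr_ge0; [exact: ndL|exact: ndx].
Qed.
End rearrangement.

Section sorted_l1.
Context {R : realType} (m : nat).
Implicit Types b c : 'cV[R]_m.

Lemma sorted_abs_perm b : exists s : 'S_m,
  (forall i : 'I_m, ord_abs b i.+1 = `|b (s i) 0|) /\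
  forall i j : 'I_m, (i <= j)%N -> `|b (s j) 0| <= `|b (s i) 0|.
Proof.
pose t := [tuple `|b j 0| | j < m].
have : perm_eq (sorted_abs b) t by rewrite /sorted_abs perm_sort.
move/tuple_permP => [s sE].
have nthE (i : 'I_m) : ord_abs b i.+1 = `|b (s i) 0|.
  rewrite /ord_abs sE/= (nth_map i) ?size_enum_ord//.
  by rewrite nth_ord_enum tnth_mktuple.
exists s; split => // i j ij; rewrite -!nthE /ord_abs/=.
have ssort : sorted (fun x y : R => y <= x) (sorted_abs b).
  by apply: sort_sorted => x y; exact: le_total.
have szE : size (sorted_abs b) = m by rewrite size_sort size_map size_enum_ord.
apply: (sorted_leq_nth _ _ 0 ssort) => //; rewrite ?inE ?szE//.
by move=> y x z /= yx zy; exact: le_trans zy yx.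
Qed.

Variable L : 'I_m -> R.
Hypothesis ndL : forall i j : 'I_m, (i <= j)%N -> L j <= L i.
Hypothesis L0 : forall i, 0 <= L i.

Definition sorted_l1 b := \sum_(i < m) L i * ord_abs b i.+1.

(** With [sorted_abs_perm], this exhibits the sorted penalty as a maximum over permutations;
    convexity and the deselection bound both use this form. *)
Lemma sorted_l1_ge b (s : 'S_m) : \sum_i L i * `|b (s i) 0| <= sorted_l1 b.
Proof.
have [s' [s'E s'nd]] := sorted_abs_perm b.
rewrite /sorted_l1; under [leRHS]eq_bigr do rewrite s'E.
have := @rearrangement _ _ L (fun i => `|b (s' i) 0|) ndL s'nd (s * s'^-1)%g.
by apply: le_trans; apply: ler_sum => i _; rewrite permM permKV.
Qed.

(** Fix the permutation sorting the midpoint and apply the triangle inequality entrywise; the two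
    resulting sums are bounded by the sorted ones. *)
Lemma sorted_l1_mid b c :
  sorted_l1 (2^-1 *: (b + c)) <= 2^-1 * (sorted_l1 b + sorted_l1 c).
Proof.
have [s [sE _]] := sorted_abs_perm (2^-1 *: (b + c)).
rewrite {1}/sorted_l1; under [leLHS]eq_bigr do rewrite sE.
apply: (@le_trans _ _ (2^-1 * (\sum_i L i * `|b (s i) 0| + \sum_i L i * `|c (s i) 0|))).
  rewrite -big_split mulr_sumr/=; apply: ler_sum => i _.
  rewrite !mxE normrM ger0_norm// -mulrDr mulrCA ler_wpM2l// ler_wpM2l//.
  exact: ler_normD.
by rewrite ler_wpM2l// lerD// sorted_l1_ge.
Qed.

Definition supp b : {set 'I_m} := [set j | b j 0 != 0]%SET.

Definition zero_at b i : 'cV[R]_m := b - b i 0 *: delta_mx i 0.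

Lemma zero_atE b i j : zero_at b i j 0 = if j == i then 0 else b j 0.
Proof.
rewrite !mxE eqxx andbT; case: eqP => [->|_]; last by rewrite mulr0 subr0.
by rewrite mulr1 subrr.
Qed.

(** Once entry [i] is zeroed, sorted position [q] (counted from 0) holds a zero, so [i] can be moved
    there at no cost; restoring [b i 0] in that slot gives a sum bounded by [sorted_l1_ge]. *)
Lemma sorted_l1_zero_at b i (q : 'I_m) : b i 0 != 0 ->
  q.+1 = #|supp b| ->
  sorted_l1 (zero_at b i) + L q * `|b i 0| <= sorted_l1 b.
Proof.
move=> bi qE; set b0 := zero_at b i.
have [s [sE snd]] := sorted_abs_perm b0.
(* Otherwise positions 0 to [q] would hold [q.+1] nonzero entries, while only [q] remain after
   deselection. *)
have b0q : b0 (s q) 0 = 0.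
  apply/eqP/negPn/negP => b0q.
  have : (#|[set s j | j in [set j : 'I_m | (j <= q)%N]]%SET| <=
          #|supp b :\ i|)%N.
    apply/subset_leq_card/fintype.subsetP => _ /imsetP[j jq ->].
    rewrite inE in jq; have : b0 (s j) 0 != 0.
      by rewrite -normr_gt0 (lt_le_trans _ (snd _ _ jq))// normr_gt0.
    by rewrite zero_atE !inE; case: (s j == i); rewrite ?eqxx.
  rewrite card_imset; last exact: perm_inj.
  have -> : #|[set j : 'I_m | (j <= q)%N]%SET| = q.+1.
    rewrite -sum1dep_card.
    rewrite -(big_ord_widen_cond m xpredT (fun=> 1%N) (ltn_ord q)).
    by rewrite sum1_card card_ord.
  have := cardsD1 i (supp b).
  by rewrite inE bi -qE add1n => -[->]; rewrite ltnn.
pose p := (s^-1)%g i; have sp : s p = i by rewrite permKV.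
pose s' := (tperm q p * s)%g.
have s'q : s' q = i by rewrite permM tpermL.
have b0s' j : b0 (s' j) 0 = b0 (s j) 0.
  rewrite permM; case: tpermP => [->|->|//]; last by rewrite b0q sp zero_atE eqxx.
  by rewrite sp b0q zero_atE eqxx.
apply: le_trans (sorted_l1_ge b s').
rewrite /sorted_l1; under eq_bigr do rewrite sE -b0s'.
rewrite (bigD1 q)//= [leRHS](bigD1 q)//= s'q zero_atE eqxx normr0 mulr0 add0r.
rewrite [leLHS]addrC; apply: lerD => //; apply: ler_sum => j jq.
by rewrite zero_atE ifN// -s'q (inj_eq perm_inj).
Qed.
End sorted_l1.

(** * Minimizers of the k-SLOPE objective *)

Section sqnorm.
Context {R : realType}.

Definition dot n (u v : 'cV[R]_n) : R := \sum_i u i 0 * v i 0.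

Lemma dotE n (u v : 'cV[R]_n) : dot u v = (u^T *m v) 0 0.
Proof. by rewrite mxE; apply: eq_bigr => i _; rewrite mxE. Qed.

Lemma sqnormE n (u : 'cV[R]_n) : sqnorm u = dot u u.
Proof. by apply: eq_bigr => i _; rewrite expr2. Qed.

Lemma sqnorm_ge0 n (u : 'cV[R]_n) : 0 <= sqnorm u.
Proof. by apply: sumr_ge0 => i _; rewrite sqr_ge0. Qed.

Lemma sqnormZ n (a : R) (u : 'cV[R]_n) : sqnorm (a *: u) = a ^+ 2 * sqnorm u.
Proof. by rewrite mulr_sumr; apply: eq_bigr => i _; rewrite mxE exprMn. Qed.

Lemma dotZr n (a : R) (u v : 'cV[R]_n) : dot u (a *: v) = a * dot u v.
Proof. by rewrite mulr_sumr; apply: eq_bigr => i _; rewrite mxE mulrCA. Qed.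

Lemma dotBl n (u u' v : 'cV[R]_n) : dot (u - u') v = dot u v - dot u' v.
Proof. by rewrite -sumrB; apply: eq_bigr => i _; rewrite !mxE mulrBl. Qed.

Lemma sqnormD n (u v : 'cV[R]_n) :
  sqnorm (u + v) = sqnorm u + 2 * dot u v + sqnorm v.
Proof.
rewrite mulr_sumr -!big_split/=; apply: eq_bigr => i _; rewrite mxE; ring.
Qed.

Lemma sqnormB n (u v : 'cV[R]_n) :
  sqnorm (u - v) = sqnorm u - 2 * dot u v + sqnorm v.
Proof.
by rewrite sqnormD -scaleN1r dotZr sqnormZ sqrrN expr1n mul1r mulN1r mulrN.
Qed.

Variables (n m : nat) (X : 'M[R]_(n, m)).
Hypothesis oX : X^T *m X = 1%:M.

Lemma dot_orth (u v : 'cV[R]_m) : dot (X *m u) (X *m v) = dot u v.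
Proof. by rewrite !dotE trmx_mul -mulmxA (mulmxA X^T) oX mul1mx. Qed.

Lemma sqnorm_orth (u : 'cV[R]_m) : sqnorm (X *m u) = sqnorm u.
Proof. by rewrite !sqnormE dot_orth. Qed.

Lemma dot_mulmx_delta (u : 'cV[R]_n) i :
  dot u (X *m delta_mx i 0) = (X^T *m u) i 0.
Proof.
by rewrite -colE mxE; apply: eq_bigr => j _; rewrite !mxE mulrC.
Qed.

Lemma sqnorm_delta (i : 'I_m) : sqnorm (delta_mx i 0 : 'cV[R]_m) = 1.
Proof.
rewrite /sqnorm (bigD1 i)//= mxE !eqxx expr1n big1 ?addr0// => j ji.
by rewrite mxE (negbTE ji) expr0n.
Qed.

Variables (k : nat) (alpha sigma : R).
Hypothesis sigma0 : 0 < sigma.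
Local Notation lam := (lambda_kfwer m k alpha).
Hypothesis nd_lam : forall i j : 'I_m, (i <= j)%N -> lam j.+1 <= lam i.+1.
Hypothesis lam0 : forall i : 'I_m, 0 <= lam i.+1.
Local Notation obj := (kslope_obj k alpha sigma X).

Let J := @sorted_l1 R m (fun i => lam i.+1).

Let objE y b : obj y b = 2^-1 * sqnorm (y - X *m b) + sigma * J b.
Proof. by []. Qed.

(* Comparing both minimizers with their midpoint makes the map from data to
   estimate Lipschitz; in particular the minimizer is unique. *)
Lemma minimizer_lipschitz y y' b b' :
  (forall c, obj y b <= obj y c) -> (forall c, obj y' b' <= obj y' c) ->
  sqnorm (b - b') <= 4 * sqnorm (y - y').
Proof.
move=> /(_ (2^-1 *: (b + b'))) + /(_ (2^-1 *: (b + b'))); rewrite !objE.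
have Jmid := sorted_l1_mid nd_lam lam0 b b'; rewrite -/J in Jmid.
(* [e] is the midpoint and [g] the image of half the difference: the two residuals are those at [e]
   shifted by [- g] and by [g]. *)
set e := 2^-1 *: (b + b') in Jmid *; pose g := X *m (2^-1 *: (b - b')).
have bE : b = e + 2^-1 *: (b - b').
  by apply/matrixP => i j; rewrite !mxE; field.
have b'E : b' = e - 2^-1 *: (b - b').
  by apply/matrixP => i j; rewrite !mxE; field.
have -> : y - X *m b = (y - X *m e) - g by rewrite {1}bE mulmxDr opprD addrA.
have -> : y' - X *m b' = (y' - X *m e) + g.
  by rewrite {1}b'E mulmxBr -/g opprB [g - _]addrC addrA.
rewrite (sqnormB (y - X *m e) g) (sqnormD (y' - X *m e) g) => h1 h2.
have gE : sqnorm (b - b') = 4 * sqnorm g.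
  by rewrite sqnorm_orth sqnormZ; field.
have dE : dot (y - y') g = dot (y - X *m e) g - dot (y' - X *m e) g.
  by rewrite -dotBl; congr (dot _ g); apply/matrixP => i j; rewrite !mxE; ring.
have := sqnorm_ge0 ((y - y') - g); rewrite (sqnormB (y - y') g) dE => h3.
have h4 : sigma * J e <= sigma * (2^-1 * (J b + J b')) by rewrite ler_wpM2l// ltW.
(* Adding [h1] and [h2], the penalties cancel by [h4] and leave [sqnorm g <= dot (y - y') g]; [h3]
   turns this into [sqnorm g <= sqnorm (y - y')]. *)
rewrite gE; lra.
Qed.

(* Compare the minimizer with the vector obtained by deselecting [i]. *)
Lemma selected_threshold y b i (q : 'I_m) : (forall c, obj y b <= obj y c) ->
  b i 0 != 0 -> q.+1 = #|supp b| -> sigma * lam q.+1 < `|(X^T *m y) i 0|.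
Proof.
move=> /(_ (zero_at b i)) + bi qE; rewrite !objE.
have := sorted_l1_zero_at nd_lam bi qE; rewrite -/J => hJ.
have -> : y - X *m zero_at b i = (y - X *m b) + b i 0 *: (X *m delta_mx i 0).
  by rewrite /zero_at mulmxBr opprB addrA addrAC scalemxAr.
rewrite (sqnormD (y - X *m b) (b i 0 *: (X *m delta_mx i 0))).
rewrite dotZr dot_mulmx_delta sqnormZ sqnorm_orth sqnorm_delta.
have -> : (X^T *m (y - X *m b)) i 0 = (X^T *m y) i 0 - b i 0.
  by rewrite mulmxBr mulmxA oX mul1mx !mxE.
set z := (X^T *m y) i 0; set x := b i 0 in hJ bi *; move=> h.
have hJ' : sigma * (J (zero_at b i) + lam q.+1 * `|x|) <= sigma * J b.
  by rewrite ler_wpM2l// ltW.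
have x0 : 0 < `|x| by rewrite normr_gt0.
have x2 : 0 < x ^+ 2 by rewrite exprn_even_gt0.
have : x * z <= `|x| * `|z| by rewrite -normrM ler_norm.
(* Minimality reads [sigma * lam q.+1 * |x| + x ^+ 2 / 2 <= x * z]; the positive square makes the
   conclusion strict. *)
rewrite -(ltr_pM2l x0); nra.
Qed.
End sqnorm.

(** * The Simes inequality *)

Section finite_simes.
Context {R : realFieldType} (I : finType) (N : {set I}).
Local Notation n0 := #|N|.
Local Notation level := {ffun I -> 'I_n0.+1}.
Implicit Types f g : level.

(* [f i = l] encodes a p-value between the [l]-th and [l+1]-st Simes thresholds;
   the last level [n0] means that no threshold is met. *)
Definition below f (j : nat) := #|[set i in N | (f i < j)%N]%SET|.

Definition simes_event f : bool :=
  [exists j : 'I_n0.+1, (0 < j)%N && (j <= below f j)%N].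

(** The rejection count of the Benjamini-Hochberg step-up rule; index 0 always qualifies and serves
    as the default. *)
Definition rejections f : 'I_n0.+1 :=
  [arg max_(j > ord0 | (j <= below f j)%N) (j : nat)]%N.

Lemma rejections_le f : (rejections f <= below f (rejections f))%N.
Proof. by rewrite /rejections; case: arg_maxnP. Qed.

Lemma rejections_max f (j : nat) : (j <= n0)%N -> (j <= below f j)%N ->
  (j <= rejections f)%N.
Proof.
move=> jn jb; rewrite /rejections; case: arg_maxnP => // k _ /(_ (inord j)).
by rewrite inordK//; apply.
Qed.

Lemma below_le f j k : (j <= k)%N -> (below f j <= below f k)%N.
Proof.
move=> jk; apply/subset_leq_card/fintype.subsetP => i; rewrite !inE.
by move=> /andP[-> /leq_trans]; apply.
Qed.

(** If more than [r] values lay below threshold [r], then [r + 1] would qualify as well, against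
    maximality. *)
Lemma below_rejections f : below f (rejections f) = rejections f.
Proof.
apply/eqP; rewrite eqn_leq rejections_le andbT leqNgt; apply/negP => lt.
have le_n : (below f (rejections f) <= n0)%N.
  by apply/subset_leq_card/fintype.subsetP => i; rewrite !inE => /andP[].
have := @rejections_max f (rejections f).+1 (leq_trans lt le_n).
by rewrite ltnn => /(_ (leq_trans lt (below_le f (leqnSn _)))).
Qed.

Definition upd f i (l : 'I_n0.+1) : level :=
  [ffun k => if k == i then l else f k].

(** Leave-one-out property of step-up rules: lowering a coordinate that is already rejected changes
    nothing, so the count is a function of the other coordinates. *)
Lemma rejections_upd f i (l : 'I_n0.+1) : i \in N -> f i = ord0 ->
  (l < rejections (upd f i l))%N -> rejections (upd f i l) = rejections f.
Proof.
move=> iN fi lt; apply/val_inj/eqP; rewrite eqn_leq; apply/andP; split.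
  apply: rejections_max; first exact: leq_ord.
  apply: leq_trans (rejections_le _) _.
  apply/subset_leq_card/fintype.subsetP => k; rewrite !inE ffunE.
  case: eqP => [->|//]; rewrite fi iN /= => _; exact: (leq_ltn_trans (leq0n _) lt).
have le_r : (rejections (upd f i l) <= rejections f)%N.
  apply: rejections_max; first exact: leq_ord.
  apply: leq_trans (rejections_le _) _.
  apply/subset_leq_card/fintype.subsetP => k; rewrite !inE ffunE.
  case: eqP => [->|//]; rewrite fi iN /= => _; exact: (leq_ltn_trans (leq0n _) lt).
apply: rejections_max; first exact: leq_ord.
apply: leq_trans (rejections_le _) _.
apply/subset_leq_card/fintype.subsetP => k; rewrite !inE ffunE.
by case: eqP => [->|//]; rewrite iN fi /= => _; exact: leq_trans lt le_r.
Qed.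

Lemma sum_upd i (F : level -> R) :
  \sum_(f : level) F f = \sum_(f : level | f i == ord0) \sum_l F (upd f i l).
Proof.
rewrite pair_big_dep/=.
rewrite (reindex_onto (fun u : level * 'I_n0.+1 => upd u.1 i u.2)
  (fun f : level => (upd f i ord0, f i)))/=; last first.
  move=> f _; apply/ffunP => k; rewrite !ffunE.
  by case: eqP => [->|].
apply: eq_big => [[f l]|//] /=; apply/eqP/idP => [[<- _]|/andP[/eqP f0 _]].
  by rewrite ffunE eqxx.
congr pair; last by rewrite ffunE eqxx.
by apply/ffunP => k; rewrite !ffunE; case: eqP => [->|].
Qed.

Variables (p : I -> 'I_n0.+1 -> R) (a : R).
Hypothesis p_ge0 : forall i l, 0 <= p i l.
Hypothesis p_sum : forall i, \sum_l p i l = 1.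
Hypothesis p_le : forall i (j : 'I_n0.+1), i \in N ->
  \sum_(l < n0.+1 | (l < j)%N) p i l <= j%:R * a.

Let w f := \prod_i p i (f i).

Lemma w_upd f i l : w (upd f i l) = p i l * \prod_(k | k != i) p k (f k).
Proof.
rewrite /w (bigD1 i)//= ffunE eqxx; congr (_ * _).
by apply: eq_bigr => k ki; rewrite ffunE (negbTE ki).
Qed.

Lemma sum_w : \sum_f w f = 1.
Proof.
rewrite /w -(bigA_distr_bigA (fun i l => p i l)).
by rewrite big1.
Qed.

(* Leave one out: given the other levels, coordinate [i] counts among the
   [r] rejections with probability at most [r * a]. *)
Lemma leave_one_out i : i \in N ->
  \sum_f w f * ((f i < rejections f)%N%:R / (rejections f)%:R) <= a.
Proof.
move=> iN.
have a0 : 0 <= a.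
  have n1 : (1 < n0.+1)%N by rewrite ltnS card_gt0; apply/set0Pn; exists i.
  by have := p_le (Ordinal n1) iN; rewrite mul1r; apply/le_trans/sumr_ge0.
rewrite (sum_upd i).
(* [a] is spread over the configurations of the other coordinates, of total mass 1, so that the
   bound can be proved term by term. *)
have -> : a = \sum_(f : level | f i == ord0) a * \prod_(k | k != i) p k (f k).
  rewrite -mulr_sumr -[LHS]mulr1; congr (_ * _); apply: etrans (esym sum_w) _.
  rewrite (sum_upd i); apply: eq_bigr => f _; under [LHS]eq_bigr do rewrite w_upd.
  by rewrite -mulr_suml p_sum mul1r.
apply: ler_sum => f /eqP fi; under [leLHS]eq_bigr do rewrite /= w_upd ffunE eqxx.
set W := \prod_(k | _) _.
have W0 : 0 <= W by apply: prodr_ge0.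
(* Where [i] is rejected, [rejections_upd] replaces the count by [rejections f], which does not
   depend on [l]. *)
apply: (@le_trans _ _ (\sum_(l < n0.+1 | (l < rejections f)%N)
    p i l * W / (rejections f)%:R)).
  rewrite [leRHS]big_mkcond/=; apply: ler_sum => l _.
  case: (ltnP l (rejections (upd f i l))) => lr; last first.
    rewrite mul0r mulr0; case: ifP => // _.
    by rewrite divr_ge0// mulr_ge0.
  by rewrite -(rejections_upd iN fi lr) lr mul1r.
under eq_bigr do rewrite -mulrA.
rewrite -mulr_suml mulrA mulrAC ler_wpM2r//.
have [->|r0] := posnP (rejections f); first by rewrite invr0 mulr0.
by rewrite ler_pdivrMr ?ltr0n// mulrC p_le.
Qed.

(** On the Simes event the [r > 0] rejected coordinates contribute [1 / r] each, so the indicator is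
    bounded by a sum over [N] of the terms treated in [leave_one_out]. *)
Lemma finite_simes : \sum_(f : level | simes_event f) w f <= n0%:R * a.
Proof.
have w0 f : 0 <= w f by apply: prodr_ge0.
apply: (@le_trans _ _ (\sum_(i in N)
    \sum_f w f * ((f i < rejections f)%N%:R / (rejections f)%:R))).
  rewrite exchange_big/= [leLHS]big_mkcond/=; apply: ler_sum => f _.
  rewrite -mulr_sumr -mulr_suml -natr_sum.
  have -> : (\sum_(i in N) (f i < rejections f) = rejections f :> nat)%N.
    rewrite -[RHS]below_rejections /below -sum1dep_card big_mkcondr/=.
    by apply: eq_bigr => i _; case: ltnP.
  case: ifP => [/existsP[j /andP[j0 jb]]|_]; last by rewrite mulr_ge0// divr_ge0.
  have r0 : (0 < rejections f)%N.
    by apply: leq_trans j0 _; apply: rejections_max => //; exact: leq_ord.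
  by rewrite divff ?mulr1// pnatr_eq0 -lt0n.
apply: le_trans (ler_sum _ leave_one_out) _.
by rewrite sumr_const mulr_natl.
Qed.

End finite_simes.

(** * The Simes inequality for independent variables *)

Lemma measure_big_setU_le d (T : measurableType d) (R : realType)
    (P : {measure set T -> \bar R}) (J : finType) (b : pred J) (F : J -> set T) :
  (forall j, measurable (F j)) ->
  measurable (\big[setU/set0]_(j | b j) F j) /\
  (P (\big[setU/set0]_(j | b j) F j) <= \sum_(j | b j) P (F j))%E.
Proof.
move=> mF; elim/big_rec2 : _ => [|j x A _ [mA PA]]; first by rewrite measure0.
split; first exact: measurableU.
by apply: le_trans (leeD2l _ PA); exact: measureU2.
Qed.

Section simes.
Context d (T : measurableType d) (R : realType) (P : probability T R).
Context (nu : probability (measurableTypeR R) R) (n : nat) (Y : 'I_n -> T -> R).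
Hypothesis mY : forall i, measurable_fun setT (Y i).
Hypothesis PY : forall B : 'I_n -> set R, (forall i, measurable (B i)) ->
  P (\bigcap_(i in [set: 'I_n]) (Y i @^-1` B i)) = (\prod_(i < n) nu (B i))%E.
Variables (N : {set 'I_n}) (A : nat -> set R) (a : R).
Hypothesis mA : forall j, measurable (A j).
Hypothesis ndA : forall j, (0 < j < #|N|)%N -> A j `<=` A j.+1.
Hypothesis nuA : forall j, (0 < j <= #|N|)%N -> (nu (A j) <= (j%:R * a)%:E)%E.

(** Padding the nested regions with the empty set and the whole line makes successive differences
    cut the line into [#|N|.+1] bands, one for each level. *)
Let A' (j : nat) : set R :=
  if j == 0%N then set0 else if (j <= #|N|)%N then A j else setT.

Let mA' j : measurable (A' j).
Proof. by rewrite /A'; case: ifP => // _; case: ifP => // _; exact: mA. Qed.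

Let ndA' j : A' j `<=` A' j.+1.
Proof.
rewrite /A'; case: posnP => [_|j0] /=; first exact: sub0set.
case: (ltnP j #|N|) => [jN|_]; last exact: subsetT.
by rewrite (ltnW jN); apply: ndA; rewrite j0.
Qed.

Let band (l : nat) := A' l.+1 `\` A' l.

Let mband l : measurable (band l).
Proof. exact: measurableD. Qed.

Let p (i : 'I_n) (l : 'I_#|N|.+1) : R := fine (nu (band l)).

Let sum_p (j : nat) i : (j <= #|N|.+1)%N ->
  \sum_(l < #|N|.+1 | (l < j)%N) p i l = fine (nu (A' j)).
Proof.
move=> jN; rewrite -(big_ord_widen _ (fun l => fine (nu (band l))) jN).
rewrite (eq_bigr (fun l : 'I_j => fine (nu (A' l.+1)) - fine (nu (A' l)))).
  rewrite -(big_mkord xpredT (fun l => fine (nu (A' l.+1)) - fine (nu (A' l)))).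
  by rewrite telescope_sumr// {2}/A' eqxx measure0 subr0.
move=> l _; rewrite /band (measureD (mu := nu) (mA' l.+1) (mA' l)); last first.
  by apply: le_lt_trans (ltry 1); exact: (probability_le1 nu (mA' _)).
rewrite setIC (setIidl (@ndA' l)) fineB//; exact: (fin_num_measure nu _ (mA' _)).
Qed.

(** The default [ord_max] is admissible because [A' #|N|.+1] is the whole line; minimality places
    [x] in the band of this index. *)
Let lev (x : R) : 'I_#|N|.+1 :=
  [arg min_(l < (ord_max : 'I_#|N|.+1) | x \in A' l.+1) (l : nat)]%N.

Let levP x : band (lev x) x /\ forall j : nat, (0 < j <= #|N|)%N -> A j x ->
  (lev x < j)%N.
Proof.
rewrite /lev; case: arg_minnP => [|l /set_mem Al lmin].
  by rewrite inE /A' /= ltnn.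
split=> [|j /andP[j0 jN] Ajx].
  split => // All; have [l0|l0] := posnP l; first by move: All; rewrite /A' l0.
  have l1 : (l.-1 < #|N|.+1)%N by rewrite (leq_ltn_trans (leq_pred _)).
  have := lmin (Ordinal l1); rewrite /= prednK// => /(_ (mem_set All)).
  by rewrite leqNgt ltn_predL l0.
have j1 : (j.-1 < #|N|.+1)%N by rewrite ltnS (leq_trans (leq_pred _)).
have := lmin (Ordinal j1); rewrite /= prednK//.
rewrite {1}/A' gtn_eqF// jN => /(_ (mem_set Ajx)) lj.
by rewrite -(prednK j0).
Qed.

Lemma simes (E : set T) : measurable E ->
  (forall w, E w -> exists2 j : nat, (0 < j <= #|N|)%N &
     (j <= #|[set i in N | `[< A j (Y i w) >]]%SET|)%N) ->
  (P E <= (#|N|%:R * a)%:E)%E.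
Proof.
move=> mE EA.
(* Recording band indices discretizes the sample: [E] is covered by the cells whose level functions
   lie in the Simes event, and each cell has product mass. *)
pose F (f : {ffun 'I_n -> 'I_#|N|.+1}) :=
  \bigcap_(i in [set: 'I_n]) (Y i @^-1` band (f i)).
have mF f : measurable (F f).
  apply: fin_bigcap_measurable => [|i _]; first exact: finite_finset.
  by rewrite -[X in measurable X]setTI; exact: mY.
have [mU PU] := measure_big_setU_le P (@simes_event _ N) mF.
apply: le_trans (le_trans PU _).
  rewrite le_measure ?inE// => w /EA[j j0N jle].
  rewrite -bigcup_seq_cond/=.
  exists [ffun i => lev (Y i w)] => /=.
    rewrite mem_index_enum; apply/existsP.
    have jN : (j < #|N|.+1)%N by rewrite ltnS; case/andP: j0N.
    exists (Ordinal jN) => /=; case/andP: (j0N) => -> _ /=.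
    apply: leq_trans jle _; apply/subset_leq_card/fintype.subsetP => i.
    rewrite !inE => /andP[-> /asboolP Aj] /=; rewrite ffunE.
    by have [_] := levP (Y i w); apply.
  by move=> i _ /=; rewrite ffunE; have [] := levP (Y i w).
have PF f : P (F f) = (\prod_i p i (f i))%:E.
  apply: etrans (PY (fun i => mband (f i))) _.
  rewrite -prodEFin; apply: eq_bigr => i _.
  by rewrite /p fineK//; exact: (fin_num_measure nu _ (mband _)).
rewrite (eq_bigr _ (fun f _ => PF f)).
rewrite sumEFin lee_fin; apply: finite_simes => //.
- by move=> i l; rewrite /p fine_ge0.
- move=> i; have := sum_p i (leqnn #|N|.+1).
  rewrite {1}/A' /= ltnn probability_setT => e; rewrite -[RHS]e.
  by apply: eq_bigl => l; rewrite ltn_ord.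
- move=> i j iN; rewrite sum_p ?(ltnW (ltn_ord j))//.
  have [->|j0] := posnP j; first by rewrite /A' eqxx measure0 mul0r.
  have jN : (j <= #|N|)%N by exact: leq_ord.
  rewrite /A' gtn_eqF// jN -lee_fin fineK ?nuA ?j0//.
  exact: (fin_num_measure nu _ (mA _)).
Qed.
End simes.

(** * Rotation invariance of the normal law *)

Section affine.
Context {R : realType}.
Local Notation mu := (@lebesgue_measure R).

(** Half-open intervals determine Lebesgue measure, and on them both sides agree by direct
    computation. *)
Lemma lebesgue_measure_affine (a b : R) (A : set R) : 0 < a -> measurable A ->
  mu A = (a%:E * mu ((fun x => (a * x + b)%R) @^-1` A))%E.
Proof.
move=> a0 mA.
pose f (x : measurableTypeR R) : measurableTypeR R := a * x + b.
have mf : measurable_fun setT f.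
  by apply: measurable_funD => //; exact: measurable_funM.
pose fm : {mfun measurableTypeR R >-> measurableTypeR R} :=
  HB.pack f (isMeasurableFun.Build _ _ _ _ _ mf).
pose a' : {nonneg R} := NngNum (ltW a0).
have := @lebesgue_measure_unique R (mscale a' (pushforward mu fm)).
apply => // _ [[u v]] _ <-.
rewrite /= /mscale /= /pushforward /=.
have -> : (fun x => a * x + b) @^-1` `]u, v] = `](u - b) / a, (v - b) / a]%classic.
  apply/seteqP; split => x /=; rewrite !in_itv/=.
    by rewrite ltr_pdivrMr// ler_pdivlMr// ltrBlDr lerBrDr mulrC.
  by rewrite ltr_pdivrMr// ler_pdivlMr// ltrBlDr lerBrDr mulrC.
rewrite !lebesgue_measure_itv/= !lte_fin ltr_pM2r ?invr_gt0// ltrD2r.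
case: ifP => _; last by rewrite mule0.
rewrite -!EFinD -EFinM; congr EFin; field; lra.
Qed.

Lemma integral_shift (c : R) (h : R -> \bar R) :
  measurable_fun setT h -> (forall x, (0 <= h x)%E) ->
  (\int[mu]_x h (x + c)%R = \int[mu]_x h x)%E.
Proof.
move=> mh h0.
pose f (x : measurableTypeR R) : measurableTypeR R := x + c.
have mf : measurable_fun setT f by exact: measurable_funD.
have := @ge0_integral_pushforward _ _ _ _ R _ mf mu setT h measurableT mh
  (fun x _ => h0 x).
rewrite preimage_setT => <-.
apply: eq_measure_integral => A mA _ /=.
rewrite (@lebesgue_measure_affine 1 c)// mul1e /pushforward.
by congr (mu _); apply/seteqP; split => x /=; rewrite mul1r.
Qed.

Lemma normal_prob_scale (s : R) (A : set R) : 0 < s -> measurable A ->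
  normal_prob 0 s A = normal_prob 0 1 ((fun x => s * x) @^-1` A).
Proof.
move=> s0 mA; rewrite /normal_prob.
pose f (x : measurableTypeR R) : measurableTypeR R := s * x.
have mf : measurable_fun setT f by exact: measurable_funM.
have mpdf t : measurable_fun setT (fun x : R => (normal_pdf 0 t x)%:E).
  by apply/measurable_EFinP; exact: measurable_normal_pdf.
have pdf0 t x : (0 <= (normal_pdf 0 t x)%:E :> \bar R)%E.
  by rewrite lee_fin normal_pdf_ge0.
rewrite (@eq_measure_integral _ (measurableTypeR R) _ A
  (mscale (NngNum (ltW s0)) (pushforward mu f))) => [|B mB _ /=]; last first.
  rewrite (@lebesgue_measure_affine s 0)// /mscale/= /pushforward.
  by congr (_ * mu _)%E; apply/seteqP; split => x /=; rewrite addr0.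
rewrite ge0_integral_mscale//; last exact: (measurable_funTS (mpdf s)).
rewrite (ge0_integral_pushforward mf)//; last exact: (measurable_funTS (mpdf _)).
have mpdfs : measurable_fun setT (fun x : R => (normal_pdf 0 s (s * x))%:E).
  apply/measurable_EFinP.
  by apply: (measurableT_comp (measurable_normal_pdf 0 s)); exact: measurable_funM.
have mfA : measurable (f @^-1` A).
  by have := mf measurableT A mA; rewrite setTI.
rewrite -ge0_integralZl//; last 2 first.
- exact: (measurable_funTS mpdfs).
- by move=> x _; exact: pdf0.
apply: eq_integral => x _ /=; rewrite -EFinM; congr EFin.
have s_neq0 : s != 0 by rewrite gt_eqF.
rewrite !normal_pdfE ?oner_neq0// /normal_peak /normal_fun !subr0.
rewrite expr1n mul1r mulrA; congr (_ * expR _); last by rewrite /f; field.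
rewrite -mulrnAr sqrtrM ?sqr_ge0// sqrtr_sqr gtr0_norm// invfM mulrA.
by rewrite divff// mul1r.
Qed.

Lemma normal_prob_sym (A : set R) : measurable A ->
  normal_prob 0 1 (-%R @^-1` A) = normal_prob 0 1 A.
Proof.
move=> mA; rewrite /normal_prob; apply/esym.
have mf : measurable_fun setT (-%R : measurableTypeR R -> measurableTypeR R) by [].
have mpdf t : measurable_fun setT (fun x : R => (normal_pdf 0 t x)%:E).
  by apply/measurable_EFinP; exact: measurable_normal_pdf.
have pdf0 t x : (0 <= (normal_pdf 0 t x)%:E :> \bar R)%E.
  by rewrite lee_fin normal_pdf_ge0.
rewrite (@eq_measure_integral _ (measurableTypeR R) _ A
  (pushforward mu (-%R : measurableTypeR R -> measurableTypeR R))) => [|B mB _ /=];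
  last exact/esym/lebesgue_measureN.
apply: etrans (ge0_integral_pushforward mf mu mA (measurable_funTS (mpdf 1)) _) _.
  by move=> x _; exact: pdf0.
apply: eq_integral => x _ /=; congr EFin.
by rewrite !normal_pdfE ?oner_neq0// /normal_fun !subr0 sqrrN.
Qed.

(** The Radon-Nikodym derivative of the normal law agrees almost everywhere with its density, both
    having the same integral over every measurable set. *)
Lemma integral_normal_prob (f : R -> \bar R) :
  (normal_prob (0:R) 1).-integrable setT f ->
  (\int[normal_prob 0 1]_x f x = \int[mu]_x (f x * (normal_pdf 0 1 x)%:E))%E.
Proof.
move=> fi.
rewrite -(Radon_Nikodym_change_of_variables (@normal_prob_dominates R 0 1))//=.
apply: ae_eq_integral => //.
- apply: emeasurable_funM => //; first exact: measurable_int fi.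
  apply: (measurable_int mu); apply: Radon_Nikodym_integrable.
  exact: normal_prob_dominates.
- apply: emeasurable_funM => //; first exact: measurable_int fi.
  by apply/measurable_EFinP; exact: measurable_normal_pdf.
- apply: ae_eqe_mul2l.
  apply: integral_ae_eq => //.
  + by apply: Radon_Nikodym_integrable; exact: normal_prob_dominates.
  + by apply/measurable_EFinP; exact: measurable_normal_pdf.
  + move=> A _ mA.
    by rewrite -Radon_Nikodym_integral//; exact: normal_prob_dominates.
Qed.
End affine.

(** * Shears and rotations of the plane *)

Section rotation.
Context {R : realType}.
Local Notation mu := (@lebesgue_measure R).
Implicit Type h : R * R -> \bar R.

Lemma measurable_fun_lin2 (a b : R) :
  measurable_fun setT (fun z : R * R => a * z.1 + b * z.2).
Proof.
by apply: measurable_funD; apply: measurable_funM.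
Qed.

Lemma iintegral_swap h : measurable_fun setT h -> (forall z, (0 <= h z)%E) ->
  (\int[mu]_x \int[mu]_y h (x, y) = \int[mu]_y \int[mu]_x h (x, y))%E.
Proof. move=> mh h0. exact: (@fubini_tonelli _ _ _ _ R mu mu h mh h0). Qed.

Lemma iintegral_sheary (c : R) h : measurable_fun setT h ->
  (forall z, (0 <= h z)%E) ->
  (\int[mu]_x \int[mu]_y h (x, y + c * x)%R = \int[mu]_x \int[mu]_y h (x, y))%E.
Proof.
move=> mh h0; apply: eq_integral => x _.
apply: (integral_shift (c * x) (h := fun y => h (x, y))) => //.
exact: (measurableT_comp mh (pair1_measurable x)).
Qed.

(** For fixed [y] the shear is a translation in [x], so the order of integration is exchanged before
    and after. *)
Lemma iintegral_shearx (c : R) h : measurable_fun setT h ->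
  (forall z, (0 <= h z)%E) ->
  (\int[mu]_x \int[mu]_y h (x + c * y, y)%R = \int[mu]_x \int[mu]_y h (x, y))%E.
Proof.
move=> mh h0; pose h' z := h (z.1 + c * z.2, z.2).
have mh' : measurable_fun setT h'.
  apply: (measurableT_comp mh); apply: measurable_fun_pair => //.
  by apply: measurable_funD => //; exact: measurable_funM.
have h'0 z : (0 <= h' z)%E by exact: h0.
apply: etrans (iintegral_swap mh' h'0) (etrans _ (esym (iintegral_swap mh h0))).
apply: eq_integral => y _.
apply: (integral_shift (c * y) (h := fun x => h (x, y))) => //.
exact: (measurableT_comp mh (pair2_measurable y)).
Qed.

Definition rot2 (a b : R) (z : R * R) : R * R :=
  (a * z.1 + b * z.2, - b * z.1 + a * z.2).

Lemma measurable_rot2 a b : measurable_fun setT (rot2 a b).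
Proof. by apply: measurable_fun_pair; exact: measurable_fun_lin2. Qed.

(* For [b != 0] a rotation is a product of three shears. *)
Lemma iintegral_rot (a b : R) h : a ^+ 2 + b ^+ 2 = 1 -> b != 0 ->
  measurable_fun setT h -> (forall z, (0 <= h z)%E) ->
  (\int[mu]_x \int[mu]_y h (rot2 a b (x, y)) = \int[mu]_x \int[mu]_y h (x, y))%E.
Proof.
(* With [a] and [b] the cosine and sine of an angle, [t] is the tangent of its half; the shears are
   by [t] in x, [- b] in y and [t] in x. *)
move=> ab b0 mh h0; pose t := (1 - a) / b.
pose h1 z := h (z.1 + t * z.2, z.2).
pose h2 z := h1 (z.1, z.2 + - b * z.1).
have mh1 : measurable_fun setT h1.
  apply: (measurableT_comp mh); apply: measurable_fun_pair => //.
  by apply: measurable_funD => //; exact: measurable_funM.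
have mh2 : measurable_fun setT h2.
  apply: (measurableT_comp mh1); apply: measurable_fun_pair => //.
  by apply: measurable_funD => //; exact: measurable_funM.
have h10 z : (0 <= h1 z)%E by exact: h0.
have h20 z : (0 <= h2 z)%E by exact: h0.
transitivity (\int[mu]_x \int[mu]_y h2 (x + t * y, y)%R)%E.
  apply: eq_integral => x _; apply: eq_integral => y _.
  rewrite /h2 /h1 /rot2 /=; congr (h (_, _)); rewrite /t.
    have -> : a * x + b * y = a * x + (1 - a ^+ 2) / b * y.
      have -> : 1 - a ^+ 2 = b * b by rewrite -ab; ring.
      by rewrite mulfK.
    by field.
  by field.
rewrite (iintegral_shearx t mh2 h20).
rewrite (iintegral_sheary (- b) mh1 h10).
exact: (iintegral_shearx t mh h0).
Qed.

Local Notation nu := (normal_prob (0 : R) 1).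
Local Notation pdf := (normal_pdf (0 : R) 1).

Lemma normal_prob2E (C : set (R * R)) : measurable C ->
  ((nu \x nu) C = \int[mu]_x \int[mu]_y (\1_C (x, y) * (pdf x * pdf y))%:E)%E.
Proof.
move=> mC; rewrite /product_measure1 integral_normal_prob; last first.
  apply: (@le_integrable _ _ _ nu setT measurableT _ (cst 1%E)) => //.
  - exact: measurable_fun_xsection.
  - move=> x _ /=; rewrite normr1 gee0_abs//.
    by apply: probability_le1; exact: measurable_xsection.
  - exact: finite_measure_integrable_cst.
apply: eq_integral => x _ /=.
rewrite [X in (X * _)%E]/normal_prob integral_mkcond/=.
rewrite muleC -ge0_integralZl//; last 3 first.
- apply/(measurable_restrictT _ (measurable_xsection _ mC)).
  by apply/measurable_EFinP/measurable_funTS; exact: measurable_normal_pdf.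
- by move=> y _; rewrite /patch; case: ifP => // _; rewrite lee_fin normal_pdf_ge0.
- by rewrite lee_fin normal_pdf_ge0.
apply: eq_integral => y _; rewrite /patch mem_xsection indicE.
by case: (_ \in C) => /=; rewrite ?mul0r ?mule0 ?mul1r.
Qed.

(** The joint density depends only on [x ^+ 2 + y ^+ 2], which the rotation preserves, as it does
    iterated Lebesgue integrals. *)
Lemma normal_prob2_rot (a b : R) (A B : set R) :
  a ^+ 2 + b ^+ 2 = 1 -> b != 0 -> measurable A -> measurable B ->
  ((nu \x nu) (rot2 a b @^-1` (A `*` B)) = nu A * nu B)%E.
Proof.
move=> ab b0 mA mB.
have mAB : measurable (A `*` B) by exact: measurableX.
have mr : measurable (rot2 a b @^-1` (A `*` B)).
  by have := measurable_rot2 a b measurableT mAB; rewrite setTI.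
have <- := product_measure1E nu nu mA mB.
rewrite (normal_prob2E mr) (normal_prob2E mAB).
have mpdf2 : measurable_fun setT (fun z : R * R => pdf z.1 * pdf z.2).
  by apply: measurable_funM; apply: (measurableT_comp (measurable_normal_pdf 0 1)).
pose h z : \bar R := (\1_(A `*` B) z * (pdf z.1 * pdf z.2))%:E.
have mh : measurable_fun setT h.
  by apply/measurable_EFinP; apply: measurable_funM => //; exact: measurable_indic.
have h0 z : (0 <= h z)%E.
  by rewrite lee_fin mulr_ge0// mulr_ge0// normal_pdf_ge0.
apply: etrans (iintegral_rot ab b0 mh h0).
apply: eq_integral => x _; apply: eq_integral => y _; congr (_ * _)%:E.
rewrite !normal_pdfE ?oner_neq0// /normal_fun !subr0/= mulrACA [RHS]mulrACA.
rewrite -!expRD; congr (_ * expR _).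
rewrite -!mulrDl -!opprD; congr (- _ / _).
rewrite -[LHS]mul1r -ab; ring.
Qed.
End rotation.

Lemma eq_measure_prod d1 d2 (T1 : measurableType d1) (T2 : measurableType d2)
    (R : realType) (m1 m2 : {measure set (T1 * T2) -> \bar R}) :
  (m1 setT < +oo)%E ->
  (forall A B, measurable A -> measurable B -> m1 (A `*` B) = m2 (A `*` B)) ->
  forall C, measurable C -> m1 C = m2 C.
Proof.
move=> m1T m12 C mC.
apply: (measure_unique [set A `*` B | A in measurable & B in measurable]
  (fun=> setT)) => //.
- exact: measurable_prod_measurableType.
- move=> _ _ [X1 mX1 [X2 mX2 <-]] [Y1 mY1 [Y2 mY2 <-]]; rewrite -setXI.
  exists (X1 `&` Y1); first exact: measurableI.
  by exists (X2 `&` Y2) => //; exact: measurableI.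
- by move=> _; exists setT => //; exists setT => //; rewrite setXTT.
- exact: bigcup_const.
- by move=> _ [A mA [B mB <-]]; exact: m12.
Qed.

(** * Orthogonal images of independent standard normals *)

Section iid.
Context d (T : measurableType d) (R : realType) (P : probability T R).
Local Notation nu := (normal_prob (0 : R) 1).

Definition iid_normal n (Z : 'I_n -> T -> R) : Prop :=
  (forall i, measurable_fun setT (Z i)) /\
  forall B : 'I_n -> set R, (forall i, measurable (B i)) ->
    P (\bigcap_(i in [set: 'I_n]) (Z i @^-1` B i)) = (\prod_(i < n) nu (B i))%E.

Definition rotv n (p q : 'I_n) (a b : R) (v : 'I_n -> R) (i : 'I_n) : R :=
  if i == p then a * v p + b * v q
  else if i == q then - b * v p + a * v q else v i.

(** The other coordinates are frozen in the event [F]: on it, the pair at [p] and [q] has law [K]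
    times the product of two normal laws, and the planar rotation applies. *)
Lemma iid_normal_rotv n (Z : 'I_n -> T -> R) (p q : 'I_n) (a b : R) :
  p != q -> a ^+ 2 + b ^+ 2 = 1 -> b != 0 -> iid_normal Z ->
  iid_normal (fun i w => rotv p q a b (Z^~ w) i).
Proof.
move=> pq ab b0 [mZ PZ]; split.
  move=> i; rewrite /rotv; case: eqP => _; last case: eqP => _ //.
    by apply: measurable_funD; apply: measurable_funM.
  by apply: measurable_funD; apply: measurable_funM.
move=> B mB.
have mpre i A : measurable A -> measurable (Z i @^-1` A).
  by move=> mA; rewrite -[X in measurable X]setTI; exact: mZ.
pose J := [set i : 'I_n | (i != p) && (i != q)].
pose F := \bigcap_(i in J) (Z i @^-1` B i).
have mF : measurable F.
  by apply: fin_bigcap_measurable => [|i _]; [exact: finite_finset|exact: mpre].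
pose f w : measurableTypeR R * measurableTypeR R := (Z p w, Z q w).
have mf : measurable_fun setT f by exact: (measurable_fun_pair (mZ p) (mZ q)).
pose K := (\prod_(i < n | (i != p) && (i != q)) nu (B i))%E.
have Kfin : (K \is a fin_num)%E.
  by apply: prode_fin_num => i _; exact: (fin_num_measure nu _ (mB i)).
have K0 : (0 <= K)%E by rewrite /K; elim/big_ind : _ => // x y; exact: mule_ge0.
pose k : {nonneg R} := NngNum (fine_ge0 K0).
have key (C : set (measurableTypeR R * measurableTypeR R)) : measurable C ->
    P (f @^-1` C `&` F) = (K * (nu \x nu) C)%E.
  move=> mC.
  have := @eq_measure_prod _ _ (measurableTypeR R) (measurableTypeR R) R
    (pushforward (mrestr P mF) f) (mscale k (nu \x nu)%E).
  rewrite /= /pushforward /mrestr /mscale /= fineK//; apply => //.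
  - rewrite preimage_setT setTI; apply: le_lt_trans (ltry 1).
    exact: probability_le1.
  - move=> A1 A2 mA1 mA2; rewrite product_measure1E//.
    pose B' i := if i == p then A1 else if i == q then A2 else B i.
    have mB' i : measurable (B' i).
      rewrite /B'; case: ifP => _; first exact: mA1.
      by case: ifP => _; [exact: mA2|exact: mB].
    transitivity (P (\bigcap_(i in [set: 'I_n]) (Z i @^-1` B' i))).
      congr (P _); apply/seteqP; split => w /=.
        move=> [[/= Ap Aq] Fw] i _; rewrite /B'; case: eqP => [->//|/eqP ip].
        by case: eqP => [->//|/eqP iq]; apply: Fw; rewrite /J /= ip iq.
      move=> H; split.
        split; first by have := H p I; rewrite /B' /= eqxx.
        by have := H q I; rewrite /B' /= eq_sym (negbTE pq) eqxx.
      move=> i /andP[ip iq]; have := H i I.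
      by rewrite /B' (negbTE ip) (negbTE iq).
    rewrite PZ// (bigD1 p)//= (bigD1 q) 1?eq_sym//= /B' eqxx.
    rewrite [q == p]eq_sym (negbTE pq) eqxx muleA muleC; congr (_ * _)%E.
    by apply: eq_bigr => i /andP[ip iq]; rewrite (negbTE ip) (negbTE iq).
have mBpq : measurable (B p `*` B q) by exact: measurableX.
have mr : measurable (rot2 a b @^-1` (B p `*` B q)).
  by have := measurable_rot2 a b measurableT mBpq; rewrite setTI.
rewrite (bigD1 p)//= (bigD1 q) 1?eq_sym//= -/K muleA.
rewrite -(normal_prob2_rot ab b0 (mB p) (mB q)) muleC -key//.
congr (P _); apply/seteqP; split => w /=.
  move=> H; split.
    split; first by have := H p I; rewrite /rotv /= eqxx.
    by have := H q I; rewrite /rotv /= eq_sym (negbTE pq) eqxx.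
  move=> i /andP[ip iq]; have := H i I.
  by rewrite /rotv /= (negbTE ip) (negbTE iq).
move=> [[/= Bp Bq] Fw] i _; rewrite /rotv /=.
case: eqP => [->//|/eqP ip]; case: eqP => [->//|/eqP iq].
by apply: Fw; rewrite /J /= ip iq.
Qed.

(** This property holds for the identity and for plane rotations with [b != 0] and passes to
    products, which is how the diagonalizing matrix is built. *)
Definition gaussian_invariant n (Q : 'M[R]_n) : Prop :=
  forall Z, iid_normal Z -> iid_normal (fun i w => \sum_j Q i j * Z j w).

Lemma gaussian_invariant1 n : gaussian_invariant (1%:M : 'M[R]_n).
Proof.
move=> Z; congr iid_normal; apply/funext => i; apply/funext => w.
rewrite (bigD1 i)//= mxE eqxx mul1r big1 ?addr0// => j ji.
by rewrite mxE eq_sym (negbTE ji) mul0r.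
Qed.

Lemma gaussian_invariantM n (Q1 Q2 : 'M[R]_n) :
  gaussian_invariant Q1 -> gaussian_invariant Q2 ->
  gaussian_invariant (Q1 *m Q2).
Proof.
move=> G1 G2 Z /G2/G1; congr iid_normal; apply/funext => i; apply/funext => w.
under eq_bigr => j _ do rewrite mulr_sumr.
rewrite exchange_big; apply: eq_bigr => j _ /=; rewrite mxE mulr_suml.
by apply: eq_bigr => k _; rewrite mulrA.
Qed.

Definition rotmx n (p q : 'I_n) (a b : R) : 'M[R]_n :=
  \matrix_(i, j) rotv p q a b (fun l => (l == j)%:R) i.

Lemma rotmxE n (p q : 'I_n) (a b : R) (v : 'I_n -> R) i :
  \sum_j rotmx p q a b i j * v j = rotv p q a b v i.
Proof.
have delta l : \sum_j (l == j)%:R * v j = v l.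
  rewrite (bigD1 l)//= eqxx mul1r big1 ?addr0// => j jl.
  by rewrite eq_sym (negbTE jl) mul0r.
under eq_bigr => j _ do rewrite mxE /rotv.
rewrite /rotv; case: eqP => _; last case: eqP => _ //.
- under eq_bigr => j _ do rewrite mulrDl -!mulrA.
  by rewrite big_split/= -!mulr_sumr !delta.
- under eq_bigr => j _ do rewrite mulrDl -!mulrA.
  by rewrite big_split/= -!mulr_sumr !delta.
Qed.

Lemma rotmx_mul n m (p q : 'I_n) (a b : R) (A : 'M[R]_(n, m)) i j :
  (rotmx p q a b *m A) i j = rotv p q a b (A^~ j) i.
Proof. by rewrite mxE -rotmxE. Qed.

Lemma rotv_dot n (p q : 'I_n) (a b : R) (u v : 'I_n -> R) : p != q ->
  a ^+ 2 + b ^+ 2 = 1 ->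
  \sum_i rotv p q a b u i * rotv p q a b v i = \sum_i u i * v i.
Proof.
move=> pq ab; have qp : q != p by rewrite eq_sym.
rewrite (bigD1 p)//= (bigD1 q)//= [RHS](bigD1 p)//= [in RHS](bigD1 q)//= !addrA.
congr (_ + _).
  rewrite /rotv !eqxx (negbTE qp) -[RHS]mul1r -ab; ring.
by apply: eq_bigr => i /andP[ip iq]; rewrite /rotv (negbTE ip) (negbTE iq).
Qed.

Lemma rotmx_orth n (p q : 'I_n) (a b : R) : p != q -> a ^+ 2 + b ^+ 2 = 1 ->
  (rotmx p q a b)^T *m rotmx p q a b = 1%:M.
Proof.
move=> pq ab; apply/matrixP => i j; rewrite !mxE.
under eq_bigr => k _ do rewrite !mxE.
rewrite rotv_dot// (bigD1 i)//= eqxx mul1r big1 ?addr0// => k ki.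
by rewrite (negbTE ki) mul0r.
Qed.

Lemma rotmx_gaussian n (p q : 'I_n) (a b : R) : p != q ->
  a ^+ 2 + b ^+ 2 = 1 -> b != 0 -> gaussian_invariant (rotmx p q a b).
Proof.
move=> pq ab b0 Z /(iid_normal_rotv pq ab b0); congr iid_normal.
by apply/funext => i; apply/funext => w; rewrite rotmxE.
Qed.

Lemma orthM n (Q1 Q2 : 'M[R]_n) : Q1^T *m Q1 = 1%:M -> Q2^T *m Q2 = 1%:M ->
  (Q1 *m Q2)^T *m (Q1 *m Q2) = 1%:M.
Proof.
by move=> o1 o2; rewrite trmx_mul mulmxA -(mulmxA Q2^T) o1 mulmx1.
Qed.

(** Givens elimination with pivot row [p]. The fixed-vector clause keeps earlier columns intact, and
    the untouched-row clause controls entries above the pivot. *)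
Lemma zero_column n (v : 'cV[R]_n) (p : 'I_n) (s : seq 'I_n) : p \notin s ->
  exists Q : 'M[R]_n, [/\ gaussian_invariant Q, Q^T *m Q = 1%:M,
    forall (u : 'cV[R]_n) i, i \notin p :: s -> (Q *m u) i 0 = u i 0,
    forall u : 'cV[R]_n, (forall i, i \in p :: s -> u i 0 = 0) -> Q *m u = u &
    forall i, i \in s -> (Q *m v) i 0 = 0].
Proof.
elim: s => [|q s IH] /=.
  move=> _; exists 1%:M; split => //; first exact: gaussian_invariant1.
  - by rewrite trmx1 mulmx1.
  - by move=> u i _; rewrite mul1mx.
  - by move=> u _; rewrite mul1mx.
rewrite inE negb_or => /andP[pq ps].
have [Q [gQ oQ Qout Qfix Qs]] := IH ps.
pose x := (Q *m v) p 0; pose y := (Q *m v) q 0.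
(* A zero entry needs no rotation; this keeps the sine [y / r] nonzero, as the decomposition into
   shears requires. *)
have [y0|y0] := eqVneq y 0.
  exists Q; split => //.
  - move=> u i; rewrite !inE !negb_or => /and3P[ip iq is_]; apply: Qout.
    by rewrite inE negb_or ip.
  - move=> u u0; apply: Qfix => i; rewrite inE => /orP[/eqP->|is_]; apply: u0.
      by rewrite !inE eqxx.
    by rewrite !inE is_ !orbT.
  - by move=> i; rewrite inE => /orP[/eqP->|/Qs].
have qs : q \notin s by apply: contra y0 => /Qs/eqP.
(* The rotation with cosine [x / r] and sine [y / r] sends [(x, y)] to [(r, 0)]. *)
pose r := Num.sqrt (x ^+ 2 + y ^+ 2).
have r2 : r ^+ 2 = x ^+ 2 + y ^+ 2 by rewrite sqr_sqrtr// addr_ge0 ?sqr_ge0.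
have r0 : r != 0.
  apply/negP => /eqP r0; move/esym/eqP: r2; rewrite r0 expr0n/=.
  by rewrite paddr_eq0 ?sqr_ge0// !expf_eq0 /= (negbTE y0) andbF.
have ab : (x / r) ^+ 2 + (y / r) ^+ 2 = 1.
  by rewrite !expr_div_n -mulrDl -r2 divff// expf_eq0.
have b0 : y / r != 0 by rewrite mulf_neq0// invr_eq0.
exists (rotmx p q (x / r) (y / r) *m Q); split.
- by apply: gaussian_invariantM => //; exact: rotmx_gaussian.
- by apply: orthM => //; exact: rotmx_orth.
- move=> u i; rewrite !inE !negb_or => /and3P[ip iq is_].
  rewrite -mulmxA rotmx_mul /rotv (negbTE ip) (negbTE iq) Qout//.
  by rewrite inE negb_or ip.
- move=> u u0; rewrite -mulmxA Qfix; last first.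
    move=> i; rewrite inE => /orP[/eqP->|is_]; apply: u0.
      by rewrite !inE eqxx.
    by rewrite !inE is_ !orbT.
  apply/matrixP => i j; rewrite rotmx_mul /rotv !ord1.
  have up : u p 0 = 0 by apply: u0; rewrite inE eqxx.
  have uq : u q 0 = 0 by apply: u0; rewrite !inE eqxx orbT.
  rewrite up uq !mulr0 addr0.
  by case: eqP => [->//|_]; case: eqP => [->|].
- move=> i; rewrite inE -mulmxA rotmx_mul /rotv => /orP[/eqP->|is_].
    rewrite eq_sym (negbTE pq) eqxx -/x -/y; field; exact: r0.
  case: eqP => [ip|_]; first by rewrite -ip is_ in ps.
  case: eqP => [iq|_]; first by rewrite -iq is_ in qs.
  exact: Qs.
Qed.

Lemma orth_dot n m (D : 'M[R]_(n, m)) (i i' : 'I_m) : D^T *m D = 1%:M ->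
  \sum_l D l i * D l i' = (i == i')%:R.
Proof.
move=> /matrixP/(_ i i'); rewrite !mxE => <-.
by apply: eq_bigr => l _; rewrite mxE.
Qed.

Lemma orth_diag_sq n m (D : 'M[R]_(n, m)) (i : 'I_m) (p : 'I_n) :
  D^T *m D = 1%:M -> (forall j, j != p -> D j i = 0) -> D p i ^+ 2 = 1.
Proof.
move=> oD D0; have := orth_dot i i oD; rewrite eqxx (bigD1 p)//= big1.
  by rewrite addr0.
by move=> l lp; rewrite D0// mulr0.
Qed.

(** Columns are treated from left to right. Entries below the diagonal are rotated away; those above
    it vanish by orthogonality to the earlier columns, each a signed unit vector. *)
Lemma orth_diagonalize n m (mn : (m <= n)%N) (A : 'M[R]_(n, m)) :
  A^T *m A = 1%:M -> forall t : nat, (t <= m)%N ->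
  exists Q : 'M[R]_n, [/\ gaussian_invariant Q, Q^T *m Q = 1%:M &
    forall (i : 'I_m) (j : 'I_n), (i < t)%N -> val j != val i ->
      (Q *m A) j i = 0].
Proof.
move=> oA; elim => [_|t IH tm].
  exists 1%:M; split => //; first exact: gaussian_invariant1.
  by rewrite trmx1 mulmx1.
have [Q [gQ oQ Qd]] := IH (ltnW tm).
pose it : 'I_m := Ordinal tm; pose p : 'I_n := widen_ord mn it.
pose s := [seq j : 'I_n <- enum 'I_n | (t < j)%N].
have ps : p \notin s by rewrite mem_filter ltnn.
have [Q2 [gQ2 oQ2 Q2out Q2fix Q2s]] := zero_column (col it (Q *m A)) ps.
have oQA : (Q *m A)^T *m (Q *m A) = 1%:M.
  by rewrite trmx_mul mulmxA -(mulmxA A^T) oQ mulmx1.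
have colE (M : 'M[R]_n) (B : 'M[R]_(n, m)) i j : (M *m B) j i = (M *m col i B) j 0.
  by rewrite !mxE; apply: eq_bigr => l _; rewrite !mxE.
exists (Q2 *m Q); split.
- exact: gaussian_invariantM.
- exact: orthM.
- move=> i j; rewrite ltnS leq_eqVlt -mulmxA colE => /orP[/eqP it_|it_] ji.
    have -> : i = it by exact: val_inj.
    have [tj|] := ltnP t j; first by apply: Q2s; rewrite mem_filter tj mem_enum.
    rewrite leq_eqVlt -it_ (negbTE ji)/= it_ => jt.
    (* Row [j] lies above the pivot and is unchanged by [Q2]; orthogonality to column [j], whose
       only nonzero entry is at row [j], forces the entry to vanish. *)
    rewrite Q2out; last first.
      by rewrite inE negb_or -val_eqE/= ltn_eqF//= mem_filter ltnNge ltnW.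
    rewrite mxE; pose i' : 'I_m := Ordinal (ltn_trans jt tm).
    have Dj l : l != j -> (Q *m A) l i' = 0 by move=> lj; apply: Qd.
    have := orth_dot i' it oQA; rewrite -val_eqE/= (ltn_eqF jt) (bigD1 j)//=.
    rewrite big1 => [|l lj]; last by rewrite Dj// mul0r.
    rewrite addr0 => /eqP; rewrite mulf_eq0 => /orP[/eqP z|/eqP //].
    by have := orth_diag_sq oQA Dj; rewrite z expr0n => /eqP; rewrite eq_sym oner_eq0.
  rewrite Q2fix; first by rewrite mxE Qd.
  move=> l; rewrite inE mem_filter => /orP[/eqP->|/andP[tl _]]; rewrite mxE Qd//.
    by rewrite /= gtn_eqF.
  by rewrite gtn_eqF// (ltn_trans it_).
Qed.

(* Only absolute values are recovered: the diagonal of [Q *m A] consists of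
   signs. *)
Lemma iid_normal_orth n m (mn : (m <= n)%N) (A : 'M[R]_(n, m)) Z :
  A^T *m A = 1%:M -> iid_normal Z ->
  exists2 Y : 'I_n -> T -> R, iid_normal Y & forall w (i : 'I_m),
    `|(A^T *m \col_j Z j w) i 0| = `|Y (widen_ord mn i) w|.
Proof.
move=> oA iZ; have [Q [gQ oQ Qd]] := orth_diagonalize mn oA (leqnn m).
exists (fun i w => \sum_j Q i j * Z j w); first exact: gQ.
move=> w i; set z := \col_j Z j w.
have -> : A^T *m z = (Q *m A)^T *m (Q *m z).
  by rewrite trmx_mul -!mulmxA (mulmxA Q^T) oQ mul1mx.
have oQA : (Q *m A)^T *m (Q *m A) = 1%:M.
  by rewrite trmx_mul mulmxA -(mulmxA A^T) oQ mulmx1.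
have off l : l != widen_ord mn i -> (Q *m A) l i = 0.
  by move=> li; apply: Qd => //; rewrite -val_eqE in li.
rewrite mxE (bigD1 (widen_ord mn i))//= big1 ?addr0; last first.
  by move=> l li; rewrite mxE off// mul0r.
rewrite mxE normrM.
have /eqP := orth_diag_sq oQA off; rewrite sqrf_eq1 => /orP[] /eqP ->.
  rewrite normr1 mul1r mxE; congr `|_|.
  by apply: eq_bigr => j _; rewrite mxE.
rewrite normrN normr1 mul1r mxE; congr `|_|.
by apply: eq_bigr => j _; rewrite mxE.
Qed.
End iid.

(** * Normal quantiles and the k-FWER thresholds *)

Section quantile.
Context {R : realType}.
Local Notation nu := (normal_prob (0 : R) 1).

Lemma PhiE (x : R) : (Phi x)%:E = nu `]-oo, x].
Proof.
have mx : measurable (`]-oo, x] : set R) by exact: measurable_itv.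
by rewrite /Phi fineK//; exact: (fin_num_measure nu _ mx).
Qed.

Lemma normal_ccdf (x : R) : nu `]x, +oo[ = (1 - Phi x)%:E.
Proof.
have mx : measurable (`]-oo, x] : set R) by exact: measurable_itv.
by rewrite -setCitvl (probability_setC nu mx) EFinB PhiE.
Qed.

Lemma normal_lower_tail (x : R) : nu `]-oo, - x[ = nu `]x, +oo[.
Proof.
rewrite -(@normal_prob_sym R `]x, +oo[)//; congr (nu _).
by rewrite opp_preimage_itvbndy.
Qed.

Lemma Phi_le_half (x : R) : x < 0 -> Phi x <= 2^-1.
Proof.
move=> x0.
suff : Phi x <= 1 - Phi x by lra.
rewrite -lee_fin PhiE -normal_ccdf -normal_lower_tail.
apply: le_measure; rewrite ?inE//.
by move=> y /=; rewrite !in_itv/= => /le_lt_trans; apply; lra.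
Qed.

(** The identity viewed as a random variable under the normal law, so that results on cumulative
    distribution functions apply to [Phi]. *)
Let idTR : measurableTypeR R -> R := idfun.

#[local] HB.instance Definition _ :=
  @isMeasurableFun.Build _ _ _ _ idTR (@measurable_id _ _ setT).

Let X : {RV nu >-> R} := idTR.

Lemma Phi_cdf (x : R) : (Phi x)%:E = cdf X x.
Proof. by rewrite PhiE. Qed.

Lemma quantile_set_neq0 (p : R) : p < 1 -> [set x | p <= Phi x] !=set0.
Proof.
move=> p1; apply/set0P/eqP => E; move: p1; apply/negP; rewrite -leNgt -lee_fin.
apply: (cvge_to_le (@cvg_cdfy1 _ _ _ _ X)); apply: nearW => x.
rewrite -Phi_cdf lee_fin leNgt; apply/negP => px.
have : [set x | p <= Phi x] x by apply: ltW.
by rewrite E.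
Qed.

(** Symmetry gives negative points mass at most one half. Together with nonemptiness, this makes the
    infimum in [Phi_inv] genuine rather than a default value. *)
Lemma quantile_set_lb (p : R) : 2^-1 < p -> lbound [set x | p <= Phi x] 0.
Proof.
move=> p2 x /= px; rewrite leNgt; apply/negP => /Phi_le_half; lra.
Qed.

Lemma Phi_inv_ge0 (p : R) : 2^-1 < p -> p < 1 -> 0 <= Phi_inv p.
Proof.
by move=> p2 p1; apply: lb_le_inf; [exact: quantile_set_neq0|exact: quantile_set_lb].
Qed.

Lemma le_Phi_inv (p q : R) : 2^-1 < p -> p <= q -> q < 1 -> Phi_inv p <= Phi_inv q.
Proof.
move=> p2 pq q1; apply: lb_le_inf; first exact: quantile_set_neq0.
move=> x /= qx; apply: ge_inf; last exact: le_trans qx.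
by exists 0; exact: quantile_set_lb.
Qed.

(** Points of the set lie arbitrarily close to its infimum, and right continuity of the distribution
    function carries the bound to the infimum itself. *)
Lemma le_Phi_Phi_inv (p : R) : 2^-1 < p -> p < 1 -> p <= Phi (Phi_inv p).
Proof.
move=> p2 p1; have S_inf : has_inf [set x | p <= Phi x].
  split; first exact: quantile_set_neq0.
  by exists 0; exact: quantile_set_lb.
rewrite -lee_fin Phi_cdf.
apply: (cvge_to_ge (@cdf_right_continuous _ _ _ _ X (Phi_inv p))).
near=> y.
have e0 : 0 < y - Phi_inv p by rewrite subr_gt0; near: y; exact: nbhs_right_gt.
have [z /= pz zy] := inf_adherent e0 S_inf.
apply: (@le_trans _ _ (cdf X z)); first by rewrite -Phi_cdf lee_fin.
by apply: cdf_nondecreasing; move: zy; rewrite -/(Phi_inv p); lra.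
Unshelve. all: by end_near. Qed.

Lemma abs_gt_setU (c : R) :
  [set x : R | c < `|x|] = `]c, +oo[%classic `|` `]-oo, (- c)[%classic.
Proof.
apply/seteqP; split => x /=; rewrite !in_itv/= andbT lter_normr ltrNr.
  by move=> /orP[]; [left|right].
by move=> [] ->; rewrite ?orbT.
Qed.

Lemma measurable_abs_gt (c : R) : measurable [set x : R | c < `|x|].
Proof. by rewrite abs_gt_setU; apply: measurableU; exact: measurable_itv. Qed.

Lemma normal_two_sided_tail (q : R) : 0 < q -> q < 2^-1 ->
  (nu [set x | (Phi_inv (1 - q) < `|x|)%R] <= (2 * q)%:E)%E.
Proof.
move=> q0 q2; set c := Phi_inv (1 - q).
rewrite abs_gt_setU.
have m1 : measurable (`]c, +oo[ : set R) by exact: measurable_itv.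
have m2 : measurable (`]-oo, (- c)[ : set R) by exact: measurable_itv.
apply: le_trans (measureU2 nu m1 m2) _.
rewrite [X in (_ + X)%E]normal_lower_tail [X in (X + _)%E]normal_ccdf.
rewrite [X in (_ + X)%E]normal_ccdf -EFinD lee_fin.
have : 1 - q <= Phi c by apply: le_Phi_Phi_inv; lra.
lra.
Qed.
End quantile.

(** The hypothesis makes [E] open for the topology pulled back along [Z], hence a countable union of
    boxes with rational centres and radii [1 / k.+1]. *)
Lemma measurable_stable d (T : measurableType d) (R : realType) n
    (Z : 'I_n -> T -> R) (E : set T) :
  (forall i, measurable_fun setT (Z i)) ->
  (forall w0, E w0 -> exists2 e : R, 0 < e &
     forall w, (forall i, `|Z i w - Z i w0| < e) -> E w) ->
  measurable E.
Proof.
move=> mZ stE.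
pose box (u : {ffun 'I_n -> rat} * nat) : set T :=
  \bigcap_(i in [set: 'I_n]) (Z i @^-1` ball (ratr (u.1 i) : R) u.2.+1%:R^-1).
have mbox u : measurable (box u).
  apply: fin_bigcap_measurable => [|i _]; first exact: finite_finset.
  by rewrite -[X in measurable X]setTI; apply: mZ => //; exact: measurable_ball.
pose F u := if `[< box u `<=` E >] then box u else set0.
have -> : E = \bigcup_u F u.
  apply/seteqP; split => [w0 Ew0|w [u _]]; last first.
    by rewrite /F; case: asboolP => // uE; exact: uE.
  have [e e0 eE] := stE w0 Ew0.
  (* In a box of radius below [e / 2], any two points differ by less than [e] in each coordinate. *)
  have [k ke] : exists k : nat, k.+1%:R^-1 < e / 2.
    have e2 : 0 < e / 2 by rewrite divr_gt0.
    exists (Num.truncn (e / 2)^-1).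
    by rewrite -[ltRHS]invrK ltf_pV2 ?posrE ?invr_gt0// truncnS_gt.
  have q_ex i : exists q : rat, `|Z i w0 - ratr q| < k.+1%:R^-1.
    have k0 : (0 : R) < k.+1%:R^-1 by rewrite invr_gt0.
    have lt : Z i w0 - k.+1%:R^-1 < Z i w0 + k.+1%:R^-1.
      by rewrite ltrBlDr -addrA ltrDl addr_gt0.
    have [q] := rat_in_itvoo lt.
    rewrite in_itv/= => /andP[q1 q2]; exists q.
    by rewrite ltr_distlC q1 q2.
  pose q i := projT1 (cid (q_ex i)).
  have qP i : `|Z i w0 - ratr (q i)| < k.+1%:R^-1 by exact: (projT2 (cid (q_ex i))).
  exists ([ffun i => q i], k) => //.
  have w0_box : box ([ffun i => q i], k) w0.
    by move=> i _ /=; rewrite /ball/= ffunE distrC.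
  rewrite /F; case: asboolP => // -[] w wbox; apply: eE => i.
  have := wbox i I; rewrite /= /ball/= ffunE => h1; have h2 := qP i.
  have -> : Z i w - Z i w0 =
    (ratr (q i) - Z i w0) - (ratr (q i) - Z i w) by ring.
  apply: le_lt_trans (ler_normB _ _) _; rewrite [X in X + _]distrC.
  by rewrite [ltRHS](splitr e) ltrD ?(lt_trans h2 ke)// (lt_trans h1 ke).
apply: countable_bigcupT_measurable => [|u]; first exact: countableP.
by rewrite /F; case: asboolP.
Qed.

(** * Comparison of the k-FWER and Simes thresholds *)

Section kslope.
Context {R : realType} (m k : nat) (alpha : R).
Hypothesis k1 : (1 <= k <= m)%N.
Hypothesis alpha01 : 0 < alpha < 1.

(** Both branches fit [m + k - maxn i k], which is [m] for [i <= k]; monotonicity then needs no case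
    split. *)
Lemma lambda_kfwerE i : lambda_kfwer m k alpha i =
  Phi_inv (1 - k%:R * alpha / (2 * (m + k - maxn i k)%:R)).
Proof.
by rewrite /lambda_kfwer; case: leqP; rewrite ?addnK.
Qed.

Lemma level_bounds (c M : nat) : (0 < c)%N -> (c <= M)%N ->
  2^-1 < 1 - c%:R * alpha / (2 * M%:R) < 1.
Proof.
move=> c0 cM; have M0 : 0 < M%:R :> R by rewrite ltr0n (leq_trans c0).
have c0' : 0 < c%:R :> R by rewrite ltr0n.
have cM' : c%:R <= M%:R :> R by rewrite ler_nat.
have [a0 a1] := andP alpha01.
have h : c%:R * alpha / (2 * M%:R) < 2^-1.
  rewrite ltr_pdivrMr ?mulr_gt0//; nra.
have h' : 0 < c%:R * alpha / (2 * M%:R) by rewrite divr_gt0 ?mulr_gt0.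
apply/andP; split; lra.
Qed.

Lemma lambda_kfwer_ge0 i : (i <= m)%N -> 0 <= lambda_kfwer m k alpha i.
Proof.
move=> im; rewrite lambda_kfwerE.
have /andP[h1 h2] := @level_bounds k (m + k - maxn i k) ltac:(lia) ltac:(lia).
exact: Phi_inv_ge0.
Qed.

(** By monotonicity of [Phi_inv], comparing quantiles reduces to comparing [c / M] with [c' / M'],
    cross-multiplied in the natural numbers. *)
Lemma Phi_inv_level_le (c M c' M' : nat) : (0 < c)%N -> (c <= M)%N ->
  (0 < c')%N -> (c' <= M')%N -> (c' * M <= c * M')%N ->
  Phi_inv (1 - c%:R * alpha / (2 * M%:R)) <= Phi_inv (1 - c'%:R * alpha / (2 * M'%:R)).
Proof.
move=> c0 cM c0' cM' le.
have /andP[h1 _] := level_bounds c0 cM; have /andP[_ h2] := level_bounds c0' cM'.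
apply: le_Phi_inv => //; rewrite lerD2l lerN2.
have M0 : 0 < M%:R :> R by rewrite ltr0n (leq_trans c0).
have M0' : 0 < M'%:R :> R by rewrite ltr0n (leq_trans c0').
have [a0 _] := andP alpha01.
rewrite ler_pdivrMr ?mulr_gt0// mulrAC ler_pdivlMr ?mulr_gt0//.
have : (c' * M)%:R <= (c * M')%:R :> R by rewrite ler_nat.
rewrite !natrM => {}le.
have -> : c'%:R * alpha * (2 * M%:R) = (2 * alpha) * (c'%:R * M%:R) by ring.
have -> : c%:R * alpha * (2 * M'%:R) = (2 * alpha) * (c%:R * M'%:R) by ring.
by rewrite ler_wpM2l// mulr_ge0// ltW.
Qed.

Lemma lambda_kfwer_nonincreasing i j : (i <= j)%N -> (j <= m)%N ->
  lambda_kfwer m k alpha j <= lambda_kfwer m k alpha i.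
Proof.
move=> ij jm; rewrite !lambda_kfwerE; apply: Phi_inv_level_le; try lia.
by rewrite leq_mul2l; apply/orP; right; lia.
Qed.

(* Among [r] selections with [V] nulls, at most [m - m0] are non-null, so the
   k-SLOPE threshold at rank [r] is at least the Simes threshold at rank [V]. *)
Lemma simes_le_lambda (V r m0 : nat) : (k <= V)%N -> (V <= r)%N -> (r <= m)%N ->
  (V <= m0)%N -> (r + m0 <= V + m)%N ->
  Phi_inv (1 - V%:R * alpha / (2 * m0%:R)) <= lambda_kfwer m k alpha r.
Proof.
move=> kV Vr rm Vm0 rm0; rewrite lambda_kfwerE; apply: Phi_inv_level_le; try lia.
rewrite (maxn_idPl (leq_trans kV Vr)).
(* The difference [V * (k + m0 - V) - k * m0] factors as [(V - k) * (m0 - V)]. *)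
apply: (@leq_trans (V * (k + m0 - V))); last by rewrite leq_mul2l; apply/orP; right; lia.
have : (k + m0 - V + V = k + m0)%N by lia.
move: kV Vm0; set x := (k + m0 - V)%N; nia.
Qed.
End kslope.

Lemma iid_normal_standardize d (T : measurableType d) (R : realType)
    (P : probability T R) n (sigma : R) (eps : 'I_n -> {RV P >-> R}) :
  0 < sigma -> mutually_independent P (fun i => (eps i : T -> R)) ->
  (forall i A, measurable A ->
     distribution P (eps i) A = normal_prob 0 sigma A) ->
  iid_normal P (fun i w => sigma^-1 * eps i w).
Proof.
move=> s0 ind law; split=> [i|B mB]; first exact: measurable_funM.
have mC i : measurable ((fun x => sigma^-1 * x) @^-1` B i).
  rewrite -[X in measurable X]setTI; apply: measurable_funM => //; exact: mB.
have := ind (fun i => (fun x => sigma^-1 * x) @^-1` B i) mC => /= ->.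
apply: eq_bigr => i _.
apply: etrans (law i _ (mC i)) _; rewrite normal_prob_scale//.
congr (normal_prob _ _ _); apply/seteqP; split => x /=;
  by rewrite mulKf// gt_eqF.
Qed.

(** * Stability of the selected set *)

Section estimator.
Context {R : realType} (n m k : nat) (X : 'M[R]_(n, m)) (sigma alpha : R).
Hypothesis oX : X^T *m X = 1%:M.
Hypothesis sigma0 : 0 < sigma.
Hypothesis k1 : (1 <= k <= m)%N.
Hypothesis alpha01 : 0 < alpha < 1.
Local Notation obj := (kslope_obj k alpha sigma X).
Local Notation lam := (lambda_kfwer m k alpha).

Let nd_lam (i j : 'I_m) : (i <= j)%N -> lam j.+1 <= lam i.+1.
Proof. by move=> ij; apply: lambda_kfwer_nonincreasing. Qed.

Let lam0 (i : 'I_m) : 0 <= lam i.+1.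
Proof. exact: lambda_kfwer_ge0. Qed.

(** By the Lipschitz bound, a small change of the data moves every entry by less than the smallest
    nonzero magnitude in [b], so no selection is lost. *)
Lemma supp_stable y b : (forall c, obj y b <= obj y c) ->
  exists2 e : R, 0 < e & forall y' b', (forall c, obj y' b' <= obj y' c) ->
    (forall j, `|y' j 0 - y j 0| < e) -> {subset supp b <= supp b'}.
Proof.
move=> minb.
(* The cap 1 keeps this minimum positive when the support is empty. *)
pose mu := \big[Order.min/1]_(i | b i 0 != 0) `|b i 0|.
have mu0 : 0 < mu by apply: lt_bigmin => // i; rewrite normr_gt0.
have mu_le i : b i 0 != 0 -> mu <= `|b i 0|.
  by exact: (@bigmin_le_cond _ _ _ _ _ (fun j => b j 0 != 0) (fun j => `|b j 0|)).
(* Chosen so that [4 * n * e ^+ 2 < mu ^+ 2]; [n.+1] covers the case [n = 0]. *)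
exists (mu / (2 * n.+1%:R)) => [|y' b' minb' close i]; first by rewrite divr_gt0// mulr_gt0.
set e := mu / _ in close.
rewrite !inE => bi; apply/eqP => b'i.
have := minimizer_lipschitz oX sigma0 nd_lam lam0 minb minb'.
apply/negP; rewrite -ltNge.
apply: (@lt_le_trans _ _ (mu ^+ 2)); last first.
  apply: (@le_trans _ _ (`|b i 0| ^+ 2)).
    by rewrite ler_pXn2r ?nnegrE ?normr_ge0 ?(ltW mu0)// mu_le.
  rewrite /sqnorm (bigD1 i)//= !mxE b'i subr0 -normrX ger0_norm ?sqr_ge0//.
  by rewrite lerDl; apply: sumr_ge0 => j _; rewrite sqr_ge0.
have e0 : 0 < e by rewrite divr_gt0// mulr_gt0.
have : sqnorm (y - y') <= e ^+ 2 *+ n.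
  rewrite -[X in _ *+ X](card_ord n) -sumr_const; apply: ler_sum => j _.
  rewrite !mxE -[leLHS]ger0_norm ?sqr_ge0// normrX distrC.
  by rewrite ler_pXn2r ?nnegrE ?normr_ge0 ?(ltW e0)// ltW// close.
have -> : mu = 2 * n.+1%:R * e by rewrite /e mulrC divfK// mulf_neq0.
rewrite -[e ^+ 2 *+ n]mulr_natl => h.
have e2 : 0 < e ^+ 2 by rewrite exprn_gt0.
apply: (@le_lt_trans _ _ (4 * (n%:R * e ^+ 2))); first by rewrite ler_wpM2l.
have -> : (2 * n.+1%:R * e) ^+ 2 = 4 * (n.+1%:R ^+ 2 * e ^+ 2) by ring.
rewrite ltr_pM2l// ltr_pM2r// -natrX ltr_nat; nia.
Qed.
End estimator.

(** * The k-FWER bound *)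

Unset Implicit Arguments.

Theorem theorem4 (R : realType) (d : measure_display) (T : measurableType d)
    (P : probability T R) (n m k : nat) (X : 'M[R]_(n, m)) (beta : 'cV[R]_m)
    (sigma alpha : R) (eps : 'I_n -> {RV P >-> R}) (betahat : T -> 'cV[R]_m) :
  (m <= n)%N ->
  X^T *m X = 1%:M ->
  0 < sigma ->
  (1 <= k <= m)%N ->
  0 < alpha < 1 ->
  mutually_independent P (fun i => (eps i : T -> R)) ->
  (forall i A, measurable A -> distribution P (eps i) A = normal_prob 0 sigma A) ->
  (forall w (b : 'cV[R]_m),
     kslope_obj k alpha sigma X (X *m beta + \col_j eps j w) (betahat w)
     <= kslope_obj k alpha sigma X (X *m beta + \col_j eps j w) b) ->
  (P [set w | (k <= #|[set i : 'I_m | (beta i ord0 == 0%R) && (betahat w i ord0 != 0%R)]%SET|)%N]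
   <= alpha%:E)%E.
Proof.
move=> mn oX s0 k1m alpha01 ind law minb.
pose N0 : {set 'I_m} := [set i | beta i ord0 == 0]%SET.
have VE w : [set i : 'I_m | (beta i ord0 == 0%R) && (betahat w i ord0 != 0%R)]%SET
    = N0 :&: supp (betahat w) by apply/setP => i; rewrite !inE.
set E := [set w | _].
(* Near any outcome of [E] the selected set can only grow, so the number of false selections stays
   at least [k]. *)
have mE : measurable E.
  apply: (measurable_stable (Z := fun i => (eps i : T -> R))) => // w0 Ew0.
  have [e e0 stab] := supp_stable oX s0 k1m alpha01 (minb w0).
  exists e => // w close; rewrite /E /= in Ew0 *; apply: leq_trans Ew0 _.
  rewrite !VE; apply/subset_leq_card/finset.setIS/fintype.subsetP.
  apply: (stab _ _ (minb w)) => j.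
  rewrite !mxE; set t := \sum_(_ < _) _.
  have -> : t + eps j w - (t + eps j w0) = eps j w - eps j w0 by ring.
  exact: close.
have [Y [mY PY] YE] := iid_normal_orth mn oX (iid_normal_standardize s0 ind law).
pose N := [set widen_ord mn i | i in N0]%SET.
have widen_inj : injective (widen_ord mn).
  by move=> i j /(congr1 val)/= ij; exact: val_inj.
have NE : #|N| = #|N0| by rewrite card_imset.
(* The region where a two-sided normal p-value falls below the Simes threshold
   [j * alpha / #|N0|]. *)
pose A (j : nat) : set R :=
  [set x | Phi_inv (1 - j%:R * alpha / (2 * #|N0|%:R)) < `|x|].
apply: (@le_trans _ _ (#|N|%:R * (alpha / #|N0|%:R))%:E); last first.
  rewrite NE lee_fin; have [->|N0pos] := posnP #|N0|.
    by rewrite mul0r; case/andP: alpha01 => /ltW.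
  by rewrite mulrC divfK// pnatr_eq0 -lt0n.
apply: (simes (nu := normal_prob 0 1) mY PY (A := A)) => //.
- by move=> j; exact: measurable_abs_gt.
- move=> j /andP[j0 jN] x /=; rewrite NE in jN; apply: le_lt_trans.
  by apply: Phi_inv_level_le => //; [exact: ltnW|rewrite leq_mul2r leqnSn orbT].
- move=> j /andP[j0 jN]; rewrite NE in jN.
  have /andP[h1 h2] := level_bounds alpha01 j0 jN.
  apply: le_trans (normal_two_sided_tail _ _) _; [lra|lra|].
  rewrite lee_fin le_eqVlt; apply/orP; left; apply/eqP.
  by field; rewrite pnatr_eq0 -lt0n (leq_trans j0).
move=> w; rewrite /E /= VE => kV.
set S := supp (betahat w) in kV; set V := #|N0 :&: S| in kV.
have [k1 km] := andP k1m.
have VN0 : (V <= #|N0|)%N by apply: subset_leq_card; exact: finset.subsetIl.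
have VS : (V <= #|S|)%N by apply: subset_leq_card; exact: finset.subsetIr.
exists V; first by rewrite NE VN0 (leq_trans k1).
have Sm : (#|S| <= m)%N by rewrite -[leqRHS]card_ord max_card.
have SN0 : (#|S| + #|N0| <= V + m)%N.
  rewrite -cardsUI finset.setIC addnC leq_add2l -[leqRHS]card_ord; exact: max_card.
have S0 : (0 < #|S|)%N by rewrite (leq_trans _ VS)// (leq_trans k1).
(* Ordinals count from 0, so rank [#|S|] of the penalty is index [#|S|.-1]; [S] is nonempty because
   [k] is positive. *)
have q_lt : (#|S|.-1 < m)%N by rewrite prednK.
apply: (@leq_trans #|[set widen_ord mn i | i in N0 :&: S]%SET|).
  by rewrite card_imset.
apply/subset_leq_card/fintype.subsetP.
move=> _ /imsetP[i /setIP[iN0 iS] ->]; rewrite inE imset_f//=.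
apply/asboolP; rewrite /A /= -YE.
apply: le_lt_trans (simes_le_lambda k1m alpha01 kV VS Sm VN0 SN0) _.
have qS : (Ordinal q_lt).+1 = #|S| by rewrite /= prednK.
have bi : betahat w i 0 != 0 by rewrite inE in iS.
have := selected_threshold oX s0 _ (minb w) bi qS.
rewrite qS mulmxDr mulmxA oX mul1mx mxE.
have -> : beta i 0 = 0 by apply/eqP; rewrite inE in iN0.
rewrite add0r.
(* At a null only the noise remains; pulling out [sigma] cancels the factor in the threshold and
   leaves the standardized variables. *)
have -> : \col_j eps j w = sigma *: \col_j (sigma^-1 * eps j w).
  by apply/matrixP => a b; rewrite !mxE mulVKf// gt_eqF.
rewrite -scalemxAr mxE normrM gtr0_norm// ltr_pM2l//; apply.
by move=> a b ab; apply: lambda_kfwer_nonincreasing.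
Qed.
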